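(* Let $s\ge 1$, $L\ge 1$ and widths $d_0=s,d_1,\dots,d_{L+1}\ge 1$. Let $W_\ell\in\mathbb{R}^{d_{\ell+1}\times d_\ell}$ and $\mathbf{v}_\ell\in\mathbb{R}^{d_{\ell+1}}$ for $\ell=0,\dots,L$, and let $\sigma:\mathbb{R}\to\mathbb{R}$ be smooth (applied componentwise to vectors). Suppose there are positive sequences $(\beta_j)_{j\ge1}$, $(R_\ell)_{\ell\ge1}$, $(A_n)_{n\ge1}$ such that $\max_{1\le p\le d_1}|W_{0,p,j}|\le\beta_j$ for all $j=1,\dots,s$; $\|W_\ell\|_\infty:=\max_{1\le p\le d_{\ell+1}}\sum_{q=1}^{d_\ell}|W_{\ell,p,q}|\le R_\ell$ for all $\ell\ge1$; and $\sup_{x\in\mathbb{R}}|\sigma^{(n)}(x)|\le A_n$ for all $n\ge1$. Define numbers $\Gamma^{[\ell]}_n$ and $\mathbb{B}^{[\ell]}_{n,\lambda}$ recursively by $\Gamma^{[1]}_n:=A_n$ for $n\ge1$; $\Gamma^{[\ell]}_n:=\sum_{\lambda=1}^n A_\lambda R_{\ell-1}^\lambda\,\mathbb{B}^{[\ell-1]}_{n,\lambda}$ for $\ell\ge2$, $n\ge1$; $\mathbb{B}^{[\ell]}_{n,1}:=\Gamma^{[\ell]}_n$ for $n\ge1$; and $\mathbb{B}^{[\ell]}_{n,\lambda}:=\sum_{i=\lambda-1}^{n-1}\binom{n-1}{i}\Gamma^{[\ell]}_{n-i}\,\mathbb{B}^{[\ell]}_{i,\lambda-1}$ for $\ell\ge1$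 and $n\ge\lambda\ge2$. Then for every depth $\ell$ with $1\le \ell\le L$, every component $1\le p\le d_{\ell+1}$, every multiindex $\boldsymbol{\nu}\in\mathbb{N}_0^s$ with $\boldsymbol{\nu}\neq\mathbf{0}$, and every $\mathbf{y}$: (a) the non-periodic network defined by $G^{[0]}_\theta(\mathbf{y}):=W_0\mathbf{y}+\mathbf{v}_0$, $G^{[\ell]}_\theta(\mathbf{y}):=W_\ell\,\sigma(G^{[\ell-1]}_\theta(\mathbf{y}))+\mathbf{v}_\ell$ ($\ell\ge1$) satisfies $$|\partial^{\boldsymbol{\nu}}G^{[\ell]}_\theta(\mathbf{y})_p|\le R_\ell\,\boldsymbol{\beta}^{\boldsymbol{\nu}}\,\Gamma^{[\ell]}_{|\boldsymbol{\nu}|};$$ (b) the periodic network defined by $G^{[0]}_\theta(\mathbf{y}):=W_0\sin(2\pi\mathbf{y})+\mathbf{v}_0$ (sine applied componentwise), $G^{[\ell]}_\theta(\mathbf{y}):=W_\ell\,\sigma(G^{[\ell-1]}_\theta(\mathbf{y}))+\mathbf{v}_\ell$ ($\ell\ge1$) satisfies $$|\partial^{\boldsymbol{\nu}}G^{[\ell]}_\theta(\mathbf{y})_p|\le R_\ell\,(2\pi)^{|\boldsymbol{\nu}|}\sum_{\mathbf{m}\le\boldsymbol{\nu}}\boldsymbol{\beta}^{\mathbf{m}}\,\Gamma^{[\ell]}_{|\mathbf{m}|}\,\mathcal{S}(\boldsymbol{\nu},\mathbf{m}),$$ where the term $\mathbf{m}=\mathbf{0}$ vanishes because $\mathcal{S}(\boldsymbol{\nu},\mathbf{0})=0$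 for $\boldsymbol{\nu}\ne\mathbf{0}$.
   Context: For $\boldsymbol{\nu}=(\nu_1,\dots,\nu_s)\in\mathbb{N}_0^s$: $|\boldsymbol{\nu}|=\sum_j\nu_j$, $\partial^{\boldsymbol{\nu}}=\prod_j(\partial/\partial y_j)^{\nu_j}$, $\boldsymbol{\beta}^{\boldsymbol{\nu}}=\prod_j\beta_j^{\nu_j}$, and $\mathbf{m}\le\boldsymbol{\nu}$ means $m_j\le\nu_j$ for all $j$. $\mathcal{S}(n,k)$ denotes the Stirling number of the second kind: $\mathcal{S}(n,0)=\delta_{n,0}$, $\mathcal{S}(n,k)=0$ for $k>n$, and $\mathcal{S}(n,k)=\frac1{k!}\sum_{i=0}^k(-1)^{k-i}\binom{k}{i}i^n$ for $n\ge k$; $\mathcal{S}(\boldsymbol{\nu},\mathbf{m}):=\prod_j\mathcal{S}(\nu_j,m_j)$. $G^{[\ell]}_\theta(\mathbf{y})_p$ denotes the $p$-th component. *)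

(* Defs.v *)
From HB Require Import structures.
From mathcomp Require Import all_boot all_order all_algebra.
From mathcomp Require Import all_classical all_reals all_analysis.
Set Implicit Arguments. Unset Strict Implicit. Unset Printing Implicit Defensive.
Import Order.TTheory GRing.Theory Num.Theory.
Import numFieldNormedType.Exports.
Local Open Scope ring_scope.

Section Defs.
Variable R : realType.

Definition smooth (f : R -> R) : Prop :=
  forall n (x : R), derivable (derive1n n f) x 1.

Definition mx_inf_norm m n (W : 'M[R]_(m, n)) : R :=
  \big[Num.max/0]_(p < m) \sum_(q < n) `|W p q|.

Fixpoint net (d : nat -> nat) (W : forall l, 'M[R]_(d l.+1, d l))
    (v : forall l, 'cV[R]_(d l.+1)) (sigma : R -> R)
    (inp : 'cV[R]_(d 0) -> 'cV[R]_(d 0)) (l : nat) : 'cV[R]_(d 0) -> 'cV[R]_(d l.+1) :=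
  match l with
  | 0 => fun y => W 0 *m inp y + v 0
  | l'.+1 => fun y => W l'.+1 *m map_mx sigma (net W v sigma inp l' y) + v l'.+1
  end.

Definition net_plain d W v sigma := @net d W v sigma id.
Definition net_periodic d W v sigma :=
  @net d W v sigma (map_mx (fun t => sin (2 * pi * t))).

Definition pderiv n (j : 'I_n) (F : 'cV[R]_n -> R) : 'cV[R]_n -> R :=
  fun y => 'D_(delta_mx j 0) F y.

Definition mderiv n (nu : 'I_n -> nat) (F : 'cV[R]_n -> R) : 'cV[R]_n -> R :=
  foldr (fun j G => iter (nu j) (pderiv j) G) F (enum 'I_n).

Definition mabs n (nu : 'I_n -> nat) : nat := (\sum_(j < n) nu j)%N.
Definition mpow n (beta : nat -> R) (nu : 'I_n -> nat) : R :=
  \prod_(j < n) beta j ^+ nu j.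

(* Stirling numbers of the second kind (explicit formula) *)
Definition stirling (n k : nat) : R :=
  if k == 0%N then (n == 0%N)%:R
  else if (n < k)%N then 0
  else (k`!%:R)^-1 * \sum_(i < k.+1) (-1) ^+ (k - i) * 'C(k, i)%:R * i%:R ^+ n.

Definition mstirling n (nu m : 'I_n -> nat) : R := \prod_(j < n) stirling (nu j) (m j).

Fixpoint Bcoef (Gam : nat -> R) (n lam : nat) : R :=
  match lam with
  | 0 => 0
  | 1 => Gam n
  | (lam'.+1 as lm).+1 =>
      \sum_(lm <= i < n) 'C(n.-1, i)%:R * Gam (n - i)%N * Bcoef Gam i lm
  end.

(* Gamma^[l]_n; Gamma 0 is unused *)
Fixpoint Gamma (A Rs : nat -> R) (l : nat) : nat -> R :=
  match l with
  | 0 => fun _ => 0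
  | l'.+1 =>
    match l' with
    | 0 => fun n => A n
    | _ => fun n => \sum_(1 <= lam < n.+1)
             A lam * Rs l' ^+ lam * Bcoef (Gamma A Rs l') n lam
    end
  end.

End Defs.

(* Main.v *)
Require Import Defs.
From HB Require Import structures.
From mathcomp Require Import all_boot all_order all_algebra.
From mathcomp Require Import all_classical all_reals all_analysis.
From mathcomp Require Import ring.
Import Order.TTheory GRing.Theory Num.Theory.
Import numFieldNormedType.Exports.
Local Open Scope ring_scope.

(* Iterated partial derivatives are indexed by words in the coordinates, which
   makes the Leibniz rule and the Faa di Bruno majorant plain inductions on the
   word, without symmetry of mixed derivatives: peeling off the innermost letter j
   of sigma(g) leaves the product sigma'(g) * d_j g, and the resulting recursion for
   the majorants is that of the partial Bell polynomials.

   For the periodic network, one differentiates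
     prod_i tau_i(y_i) * F(sin(2 pi y)),
   where tau_i is a trigonometric form of degree k_i.  A derivative in y_j either
   hits tau_j, which costs a factor 2 pi k_j, or hits F, which multiplies tau_j by
   2 pi cos(2 pi y_j) and so raises k_j by one.  Solving this recursion in k gives
   the numbers (1/p!) sum_i (-1)^(p-i) C(p,i) (i+k)^m, which are the Stirling
   numbers at k = 0. *)

(** * Partial derivatives along words *)

Section WordDerivatives.
Variables (R : realType) (n : nat).
Implicit Types (f g F : 'cV[R]_n -> R) (s t : seq 'I_n) (j : 'I_n).
Implicit Types (y : 'cV[R]_n).

(** The head of the word is applied last, so [rcons] exposes the innermost derivative, the one on
    which the inductions below proceed. *)
Definition wderiv s F : 'cV[R]_n -> R := foldr (@pderiv R n) F s.

Lemma wderiv_rcons s j F : wderiv (rcons s j) F = wderiv s (pderiv j F).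
Proof. by rewrite /wderiv -cats1 foldr_cat. Qed.

(** The letters come in the order in which [mderiv] composes its derivatives, so both agree without
    commuting any of them. *)
Definition word_of (nu : 'I_n -> nat) : seq 'I_n :=
  flatten [seq nseq (nu j) j | j <- enum 'I_n].

Lemma mderiv_word nu F : mderiv nu F = wderiv (word_of nu) F.
Proof.
rewrite /mderiv /wderiv /word_of; elim: (enum _) => //= j s ->.
by rewrite foldr_cat; elim: (nu j) => //= k ->.
Qed.

Lemma count_word_of nu j : count_mem j (word_of nu) = nu j.
Proof.
rewrite /word_of count_flatten -map_comp sumnE big_map enumT -enumT big_enum /=.
rewrite (bigD1 j) //= count_nseq /= eqxx mul1n big1 ?addn0 // => i /negPf ij.
by rewrite count_nseq /= ij.
Qed.

Lemma size_word_of nu : size (word_of nu) = mabs nu.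
Proof.
rewrite /word_of size_flatten /shape -map_comp sumnE big_map big_enum /=.
by apply: eq_bigr => i _; rewrite /= size_nseq.
Qed.

Definition wpow (beta : nat -> R) s : R := \prod_(j <- s) beta j.

Lemma wpow_word_of beta nu : wpow beta (word_of nu) = mpow beta nu.
Proof.
rewrite /wpow /word_of /mpow big_flatten big_map big_enum /=.
by apply: eq_bigr => i _; rewrite big_nseq iter_mulr_1.
Qed.

Lemma wpow_rcons beta s j : wpow beta (rcons s j) = wpow beta s * beta j.
Proof. by rewrite /wpow -cats1 big_cat big_seq1. Qed.

(* Differentiability in every coordinate direction, iterated [N] times; joint
   differentiability is never needed because all chain rules used below are
   one-dimensional. *)
Fixpoint pdiff (N : nat) F : Prop :=
  if N is N'.+1 then
    forall j, (forall y, derivable F y (delta_mx j 0)) /\ pdiff N' (pderiv j F)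
  else True.

Lemma is_derive_pderiv N F j y :
  pdiff N.+1 F -> is_derive y (delta_mx j 0) F (pderiv j F y).
Proof. by move=> /(_ j)[dF _]; apply/derivableP. Qed.

Lemma pdiffW N F : pdiff N.+1 F -> pdiff N F.
Proof.
elim: N F => //= N IH F dF j; have [d1 d2] := dF j.
by split => //; apply: IH.
Qed.

Lemma pdiffP N F (F' : 'I_n -> 'cV[R]_n -> R) :
  (forall j y, is_derive y (delta_mx j 0) F (F' j y)) ->
  (forall j, pdiff N (F' j)) ->
  pdiff N.+1 F /\ forall j, pderiv j F = F' j.
Proof.
move=> dF dF'; have E j : pderiv j F = F' j.
  by apply/funext => y; rewrite /pderiv derive_val.
split=> [j|//]; split=> [y|]; first by case: (dF j y).
by rewrite E; apply: dF'.
Qed.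

Lemma pdiff_cst N (c : R) : pdiff N (fun=> c).
Proof.
elim: N c => // N IH c.
apply: (proj1 (pdiffP N (fun=> c) (fun _ _ => 0) _ _)) => j.
exact: IH.
Qed.

Lemma pderivD N f g j : pdiff N.+1 f -> pdiff N.+1 g ->
  pderiv j (fun y => f y + g y) = (fun y => pderiv j f y + pderiv j g y).
Proof.
move=> df dg; apply/funext => y; apply: derive_val.
by apply: is_deriveD; apply: is_derive_pderiv; eassumption.
Qed.

Lemma pdiffD N f g : pdiff N f -> pdiff N g -> pdiff N (fun y => f y + g y).
Proof.
elim: N f g => // N IH f g df dg j; split.
  by move=> y; apply: derivableD; [case: (df j)|case: (dg j)].
by rewrite (pderivD _ _ _ _ df dg); apply: IH; [case: (df j)|case: (dg j)].
Qed.

Lemma pderivM N f g j : pdiff N.+1 f -> pdiff N.+1 g ->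
  pderiv j (fun y => f y * g y) = (fun y => pderiv j f y * g y + f y * pderiv j g y).
Proof.
move=> df dg; apply/funext => y; apply: derive_val.
have := is_deriveM (is_derive_pderiv _ _ j y df) (is_derive_pderiv _ _ j y dg).
by move=> /is_derive_eq; apply; rewrite addrC [g y *: _]mulrC.
Qed.

Lemma pdiffM N f g : pdiff N f -> pdiff N g -> pdiff N (fun y => f y * g y).
Proof.
elim: N f g => // N IH f g df dg j; split.
  by move=> y; apply: derivableM; [case: (df j)|case: (dg j)].
rewrite (pderivM _ _ _ _ df dg); apply: pdiffD; apply: IH.
- by case: (df j).
- exact: pdiffW.
- exact: pdiffW.
- by case: (dg j).
Qed.

Lemma wderivD s f g : pdiff (size s) f -> pdiff (size s) g ->
  wderiv s (fun y => f y + g y) = (fun y => wderiv s f y + wderiv s g y).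
Proof.
elim/last_ind: s f g => // s j IH f g; rewrite size_rcons => df dg.
rewrite !wderiv_rcons (pderivD _ _ _ _ df dg) IH //.
- by case: (df j).
- by case: (dg j).
Qed.

Lemma wderivZ s f (c : R) : pdiff (size s) f ->
  wderiv s (fun y => c * f y) = (fun y => c * wderiv s f y).
Proof.
elim/last_ind: s f => // s j IH f; rewrite size_rcons => df.
rewrite !wderiv_rcons -IH; last by case: (df j).
congr wderiv; apply/funext => y; apply: derive_val.
exact/is_deriveZ/is_derive_pderiv/df.
Qed.

Lemma wderiv_cst s (c : R) : wderiv s (fun=> c) = (fun=> if s is [::] then c else 0).
Proof.
elim: s => //= j s ->; apply/funext => y; rewrite /pderiv.
by apply: derive_val; apply: is_derive_cst.
Qed.

Lemma pdiff_sum N (I : finType) (w : I -> R) (f : I -> 'cV[R]_n -> R) :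
  (forall q, pdiff N (f q)) -> pdiff N (fun y => \sum_q w q * f q y).
Proof.
move=> df; elim: (index_enum I) => [|q r IH].
  under eq_fun do rewrite big_nil; exact: pdiff_cst.
under eq_fun do rewrite big_cons; apply: pdiffD => //.
by apply: pdiffM => //; apply: pdiff_cst.
Qed.

Lemma wderiv_sum s (I : finType) (w : I -> R) (f : I -> 'cV[R]_n -> R) :
  (forall N q, pdiff N (f q)) ->
  wderiv s (fun y => \sum_q w q * f q y) = (fun y => \sum_q w q * wderiv s (f q) y).
Proof.
move=> df.
(* Differentiability of the partial sums is carried through the induction because [wderivD] asks for
   it. *)
suff: pdiff (size s) (fun y => \sum_q w q * f q y) /\
  wderiv s (fun y => \sum_q w q * f q y)
  = (fun y => \sum_q w q * wderiv s (f q) y) by case.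
elim: (index_enum I) => [|q r [IH1 IH2]].
  have nilE (h : I -> 'cV[R]_n -> R) :
      (fun y => \sum_(i <- [::]) w i * h i y) = fun=> 0.
    by apply/funext => y; rewrite big_nil.
  rewrite !nilE.
  by rewrite wderiv_cst; split; [apply: pdiff_cst|case: (s)].
have consE (h : I -> 'cV[R]_n -> R) :
    (fun y => \sum_(i <- q :: r) w i * h i y) =
    fun y => w q * h q y + \sum_(i <- r) w i * h i y.
  by apply/funext => y; rewrite big_cons.
rewrite !consE.
have dq : pdiff (size s) (fun y => w q * f q y).
  by apply: pdiffM => //; apply: pdiff_cst.
split; first exact: pdiffD.
by rewrite wderivD // IH2 wderivZ.
Qed.

End WordDerivatives.

Arguments wderiv {R n}.
Arguments word_of {n}.
Arguments wpow {R n}.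
Arguments pdiff {R n}.

(** * Leibniz and Faa di Bruno majorants *)

(** Restriction to a line turns a directional derivative into an ordinary one, so that the
    one-variable chain rule becomes available. *)
Lemma is_derive_line (R : realType) (V : normedModType R) (F : V -> R) (y v : V) (dF : R) :
  is_derive y v F dF <-> is_derive (0 : R) 1 (fun h : R => F (h *: v + y)) dF.
Proof.
have E : 'D_v F y = 'D_1 (fun h : R => F (h *: v + y)) 0.
  rewrite /derive; set g1 := fun h => h^-1 *: _; set g2 := fun h => h^-1 *: _.
  suff -> : g1 = g2 by [].
  by rewrite funeqE /g1 /g2 => h /=; rewrite addr0 scale0r add0r [_%:A]mulr1.
split=> -[d1 d2]; apply: DeriveDef.
- exact: (derivable1P _ _ _).1 d1.
- by rewrite -E.
- exact: (derivable1P _ _ _).2 d1.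
- by rewrite E.
Qed.

Lemma is_derive_comp (R : realType) (V : normedModType R) (tau : R -> R) (g : V -> R)
    (y v : V) (dtau dg : R) :
  is_derive (g y) 1 tau dtau -> is_derive y v g dg ->
  is_derive y v (fun z => tau (g z)) (dtau * dg).
Proof.
move=> dt /is_derive_line dl; apply/is_derive_line.
apply: (@is_derive1_comp R tau (fun h : R => g (h *: v + y))) => //.
by rewrite scale0r add0r.
Qed.

Section Composition.
Variables (R : realType) (n : nat).
Implicit Types (f g : 'cV[R]_n -> R) (s t : seq 'I_n) (j : 'I_n) (y : 'cV[R]_n).

(** The weights of a subword and of its complement multiply to [wpow beta s]. As the majorants
    depend on the length only, the Leibniz sum over subwords collapses to a binomial sum. *)
Lemma leibniz_bound (beta : nat -> R) s f g (phi psi : nat -> R) y :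
  pdiff (size s) f -> pdiff (size s) g ->
  (forall t, (size t <= size s)%N -> `|wderiv t f y| <= wpow beta t * phi (size t)) ->
  (forall t, (size t <= size s)%N -> `|wderiv t g y| <= wpow beta t * psi (size t)) ->
  `|wderiv s (fun z => f z * g z) y| <=
  wpow beta s * \sum_(i < (size s).+1) 'C(size s, i)%:R * phi i * psi (size s - i)%N.
Proof.
elim/last_ind: s f g phi psi => [|s j IH] f g phi psi.
  move=> _ _ /(_ [::] isT) /= bf /(_ [::] isT) /= bg.
  rewrite big_ord_recl big_ord0 /wpow big_nil /= bin0 subn0 !mul1r addr0.
  rewrite /wpow big_nil mul1r in bf; rewrite /wpow big_nil mul1r in bg.
  by rewrite normrM ler_pM.
rewrite size_rcons => df dg bf bg.
have [df1 df2] := df j; have [dg1 dg2] := dg j.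
have df' := pdiffW _ _ _ _ df; have dg' := pdiffW _ _ _ _ dg.
(* A derivative in [y_j] shifts the majorant sequence by one and multiplies it by [beta j]. *)
have shift h chi : (forall t, (size t <= (size s).+1)%N ->
    `|wderiv t h y| <= wpow beta t * chi (size t)) ->
    forall t, (size t <= size s)%N ->
    `|wderiv t (pderiv j h) y| <= wpow beta t * (beta j * chi (size t).+1).
  move=> bh t tS; rewrite -wderiv_rcons mulrA -wpow_rcons -(size_rcons t j).
  by apply: bh; rewrite size_rcons.
have B1 := IH (pderiv j f) g (fun i => beta j * phi i.+1) psi df2 dg' (shift _ _ bf)
  (fun t tS => bg t (leqW tS)).
have B2 := IH f (pderiv j g) phi (fun i => beta j * psi i.+1) df' dg2
  (fun t tS => bf t (leqW tS)) (shift _ _ bg).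
rewrite wderiv_rcons (pderivM _ _ _ _ _ _ df dg) wderivD; last 2 first.
- exact: pdiffM.
- exact: pdiffM.
apply: le_trans (ler_normD _ _) _; apply: le_trans (lerD B1 B2) _.
rewrite wpow_rcons -mulrDr -mulrA; rewrite le_eqVlt; apply/predU1P; left; congr (_ * _).
set m := size s.
rewrite [in RHS]big_ord_recl bin0 subn0 mul1r.
transitivity (beta j * (\sum_(i < m.+1) 'C(m, i)%:R * phi i.+1 * psi (m - i)%N +
   \sum_(i < m.+1) 'C(m, i)%:R * phi i * psi (m - i).+1)).
  by rewrite mulrDr !mulr_sumr; congr (_ + _); apply: eq_bigr => i _; ring.
congr (_ * _); rewrite [X in _ + X]big_ord_recl bin0 subn0 mul1r addrCA; congr (_ + _).
(* The added term [i = m] is zero since ['C(m, m.+1) = 0]; both sums then have the same range and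
   combine by Pascal's rule. *)
have -> : \sum_(i < m) 'C(m, bump 0 i)%:R * phi (bump 0 i) * psi (m - bump 0 i).+1 =
   \sum_(i < m.+1) 'C(m, i.+1)%:R * phi i.+1 * psi (m - i)%N.
  rewrite big_ord_recr /= bin_small // !mul0r addr0; apply: eq_bigr => i _.
  by rewrite /bump add1n subnSK.
rewrite -big_split /=; apply: eq_bigr => i _.
rewrite /bump add1n subSS binS natrD; ring.
Qed.

(* Partial Bell polynomials, with the convention [bell 0 0 = 1] that [Bcoef]
   lacks. *)
Fixpoint bell (x : nat -> R) (m lam : nat) : R :=
  if lam is lam'.+1 then
    \sum_(i < m) 'C(m.-1, i)%:R * x (m - i)%N * bell x i lam'
  else (m == 0%N)%:R.

Lemma bell_small x m lam : (m < lam)%N -> bell x m lam = 0.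
Proof.
elim: lam m => // lam IH m; rewrite ltnS => ml /=; apply: big1 => i _.
by rewrite IH ?mulr0 // (leq_trans (ltn_ord i)).
Qed.

Lemma bell_Bcoef x m lam : (0 < lam <= m)%N -> bell x m lam = Bcoef x m lam.
Proof.
elim: lam m => // -[_|lam IH] m /andP[_ lm].
  case: m lm => // m _ /=; rewrite big_ord_recl /= bin0 subn0 mul1r mulr1.
  by rewrite big1 ?addr0 // => i _; rewrite mulr0.
have -> : bell x m lam.+2 =
    \sum_(0 <= i < m) 'C(m.-1, i)%:R * x (m - i)%N * bell x i lam.+1.
  by rewrite big_mkord.
have -> : Bcoef x m lam.+2 =
    \sum_(lam.+1 <= i < m) 'C(m.-1, i)%:R * x (m - i)%N * Bcoef x i lam.+1 by [].
(* The terms with [i < lam.+1] vanish by [bell_small], which accounts for the lower summation bound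
   in [Bcoef]. *)
set B := bell x; rewrite (@big_cat_nat _ _ _ lam.+1) //=; last exact: ltnW.
rewrite [X in X + _]big_nat_cond big1 ?add0r; last first.
  by move=> i /andP[/andP[_ il] _]; rewrite /B bell_small ?mulr0.
by apply: eq_big_nat => i /andP[il im]; rewrite /B IH.
Qed.

(** Homogeneity: each of the [lam] blocks contributes one factor [r]. This produces the powers
    [Rs l ^+ lam] in [Gamma]. *)
Lemma bell_scale (r : R) x m lam : bell (fun i => r * x i) m lam = r ^+ lam * bell x m lam.
Proof.
elim: lam m => [|lam IH] m /=; first by rewrite mul1r.
by rewrite mulr_sumr; apply: eq_bigr => i _; rewrite IH exprS; ring.
Qed.

Variable (sigma : R -> R).
Hypothesis sigma_smooth : smooth sigma.

Lemma is_derive_sigma_comp k g (dg : R) y v :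
  is_derive y v g dg ->
  is_derive y v (fun z => derive1n k sigma (g z)) (derive1n k.+1 sigma (g y) * dg).
Proof.
move=> dgy; apply: is_derive_comp => //.
by rewrite derive1nS derive1E; apply/derivableP/sigma_smooth.
Qed.

Lemma pderiv_sigma_comp N k g j : pdiff N.+1 g ->
  pderiv j (fun z => derive1n k sigma (g z)) =
  (fun z => derive1n k.+1 sigma (g z) * pderiv j g z).
Proof.
move=> dg; apply/funext => y; apply: derive_val.
by apply: is_derive_sigma_comp; apply: is_derive_pderiv dg.
Qed.

Lemma pdiff_sigma_comp N k g : pdiff N g -> pdiff N (fun z => derive1n k sigma (g z)).
Proof.
elim: N k g => // N IH k g dg j; split.
  move=> y; apply: ex_derive.
  by apply: is_derive_sigma_comp; apply: is_derive_pderiv dg.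
rewrite (pderiv_sigma_comp N) //; apply: pdiffM; last by case: (dg j).
by apply: IH; apply: pdiffW.
Qed.

(** The innermost derivative yields [derive1n k.+1 sigma (g z) * pderiv j g z]. Leibniz applies to
    this product, the first factor being bounded by induction for all shorter words at once. The
    common [N] gives these words sums of equal length; terms with [lam] above the word length
    vanish. *)
Lemma faa_di_bruno_bound (beta x A : nat -> R) N k s g y :
  (size s < N)%N -> (forall M, pdiff M g) ->
  (forall t, t != [::] -> `|wderiv t g y| <= wpow beta t * x (size t)) ->
  (forall i, `|derive1n (k + i) sigma (g y)| <= A (k + i)%N) ->
  `|wderiv s (fun z => derive1n k sigma (g z)) y| <=
  wpow beta s * \sum_(lam < N) A (k + lam)%N * bell x (size s) lam.
Proof.
move=> + dg bg; elim: N k s => // N IH k s.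
case/lastP: s => [_ bs|s j].
  rewrite big_ord_recl /= big1 => [|i _]; last by rewrite big_ord0 mulr0.
  by rewrite /wpow big_nil mulr1 addr0 mul1r; have := bs 0%N; rewrite !addn0.
rewrite size_rcons ltnS => sN bs.
rewrite wderiv_rcons (pderiv_sigma_comp 0) //.
pose phi m := \sum_(lam < N) A (k.+1 + lam)%N * bell x m lam.
have dg' M : pdiff M (pderiv j g) by case: (dg M.+1 j).
have := @leibniz_bound beta s (fun z => derive1n k.+1 sigma (g z)) (pderiv j g) phi
  (fun i => beta j * x i.+1) y.
have H1 : pdiff (size s) (fun z => derive1n k.+1 sigma (g z)).
  exact: pdiff_sigma_comp.
move=> /(_ H1 (dg' _)) /(_ _ _)/le_trans; apply.
- move=> t tS; apply: IH; first exact: leq_ltn_trans tS sN.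
  by move=> i; rewrite addSnnS.
- move=> t tS; rewrite -wderiv_rcons mulrA -wpow_rcons -(size_rcons t j).
  by apply: bg; rewrite -size_eq0 size_rcons.
rewrite wpow_rcons -mulrA; rewrite le_eqVlt; apply/predU1P; left; congr (_ * _).
(* For a nonempty word the term [lam = 0] is zero. After exchanging the sums, the coefficient of
   [A (k.+1 + lam)] is the recursion defining [bell] at [lam.+1]. *)
rewrite [in RHS]big_ord_recl [X in _ * (X + _)]mulr0 add0r [in RHS]mulr_sumr /phi.
under eq_bigr do rewrite mulr_sumr mulr_suml.
rewrite exchange_big; apply: eq_bigr => lam _.
rewrite lift0 -addSnnS [bell _ _ lam.+1]/= !mulr_sumr; apply: eq_bigr => i _.
by rewrite subSn; [ring | rewrite -ltnS].
Qed.

End Composition.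

(** * The non-periodic network *)

Lemma is_derive_affine (R : realType) (V : normedModType R) (F : V -> R) (y v : V) (c : R) :
  (forall h : R, F (h *: v + y) = h * c + F y) -> is_derive y v F c.
Proof.
move=> E; apply/is_derive_line.
rewrite (_ : (fun h : R => _) = (id * cst c) + cst (F y)); last first.
  by apply/funext => h; rewrite E.
apply: is_derive_eq; rewrite /= addr0.
by rewrite scaler0 add0r [LHS]mulr1.
Qed.

(** With weight on blocks of size one only, the partition into singletons is the only one that
    counts. This is the case of an affine inner function. *)
Lemma bell_delta1 (R : realType) m lam :
  bell R (fun k => (k == 1%N)%:R) m lam = (m == lam)%:R.
Proof.
elim: lam m => // lam IH [|m] /=; first by rewrite big_ord0.
rewrite big_ord_recr /= binn subSnn mul1r mul1r IH eqSS big1 ?add0r // => i _.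
by rewrite subSn 1?ltnW // eqSS subn_eq0 leqNgt ltn_ord mulr0 mul0r.
Qed.

Section PlainNetwork.
Variables (R : realType) (L : nat) (d : nat -> nat).
Variables (W : forall l, 'M[R]_(d l.+1, d l)) (v : forall l, 'cV[R]_(d l.+1)).
Variables (sigma : R -> R) (beta Rs A : nat -> R).
Hypothesis d_gt0 : forall l, (l <= L.+1)%N -> (1 <= d l)%N.
Hypothesis sigma_smooth : smooth sigma.
Hypothesis W0_le : forall j : 'I_(d 0%N), \big[Num.max/0]_(p < d 1%N) `|W 0%N p j| <= beta j.
Hypothesis W_le : forall l, (1 <= l <= L)%N -> mx_inf_norm (W l) <= Rs l.
Hypothesis sigma_le : forall m, (1 <= m)%N -> forall x, `|derive1n m sigma x| <= A m.

Local Notation G l p := (fun z : 'cV[R]_(d 0%N) => net_plain W v sigma l z p 0).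

Lemma net_plainS l (p : 'I_(d l.+2)) :
  G l.+1 p = fun z => \sum_q W l.+1 p q * sigma (net_plain W v sigma l z q 0) + v l.+1 p 0.
Proof.
apply/funext => z; rewrite /net_plain /= mxE mxE; congr (_ + _).
by apply: eq_bigr => q _; rewrite mxE.
Qed.

Lemma is_derive_net0 (p : 'I_(d 1%N)) j y :
  is_derive y (delta_mx j 0) (G 0%N p) (W 0%N p j).
Proof.
apply: is_derive_affine => h.
rewrite /net_plain /= mulmxDr -scalemxAr -addrA mxE; congr (_ + _).
by rewrite mxE -colE mxE.
Qed.

(** Layer 0 is affine, so only first-order derivatives survive, and these are bounded by [beta] with
    no further factor. *)
Definition net_majorant l m : R :=
  if l is 0 then (m == 1%N)%:R else Rs l * Gamma A Rs l m.

(** Both clauses of the recursion for [Gamma] are one composition rule: the affine layer leaves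
    [A m], and a later layer contributes [Rs l ^+ lam] by homogeneity. *)
Lemma Gamma_bell l m : (0 < m)%N ->
  \sum_(1 <= lam < m.+1) A lam * bell R (net_majorant l) m lam = Gamma A Rs l.+1 m.
Proof.
case: l => [|l] m0.
  rewrite big_nat_recr //= bell_delta1 eqxx mulr1 big_nat_cond big1 ?add0r //.
  move=> i /andP[/andP[_ im] _]; rewrite bell_delta1.
  by rewrite gtn_eqF ?mulr0.
apply: eq_big_nat => lam /andP[l0 lm].
by rewrite bell_scale bell_Bcoef ?mulrA // l0.
Qed.

Lemma sigma_comp_bound l (g : 'cV[R]_(d 0%N) -> R) s y :
  (forall M, pdiff M g) -> s != [::] ->
  (forall t, t != [::] -> `|wderiv t g y| <= wpow beta t * net_majorant l (size t)) ->
  `|wderiv s (fun z => sigma (g z)) y| <= wpow beta s * Gamma A Rs l.+1 (size s).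
Proof.
(* At order 0 the value of [sigma] at the point itself serves as bound; its coefficient [bell _ m 0]
   is zero for a nonempty word. *)
move=> dg s0 bg; pose A' k := if k is 0 then `|sigma (g y)| else A k.
have := faa_di_bruno_bound _ _ _ sigma_smooth beta (net_majorant l) A'
  (size s).+1 0 s g y (leqnn _) dg bg.
have sp : (0 < size s)%N by case: (s) s0.
rewrite -Gamma_bell // big_add1 big_mkord big_ord_recl /= gtn_eqF // mulr0 add0r.
by apply=> -[|i]; [exact: lexx | exact: (sigma_le i.+1)].
Qed.

(** Induction on the layers: composition with [sigma] turns the majorant of layer [l] into [Gamma]
    at [l.+1], and a row of the next weight matrix contributes its l1-norm, at most [Rs l.+1]. *)
Lemma net_plain_bound l : (l <= L)%N -> forall p : 'I_(d l.+1),
  (forall M, pdiff M (G l p)) /\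
  forall s y, s != [::] ->
    `|wderiv s (G l p) y| <= wpow beta s * net_majorant l (size s).
Proof.
elim: l => [|l IH] lL p.
  have dG M : pdiff M.+1 (G 0%N p) /\ forall j, pderiv j (G 0%N p) = fun=> W 0%N p j.
    apply: (pdiffP _ _ M (G 0%N p) (fun j _ => W 0%N p j)) => j; last exact: pdiff_cst.
    by move=> y; apply: is_derive_net0.
  split=> [M|s y]; first by apply: pdiffW; case: (dG M).
  case/lastP: s => // s j _; rewrite wderiv_rcons size_rcons wpow_rcons.
  case: (dG 0%N) => _ ->; rewrite wderiv_cst; case: s => [|i s] /=.
    rewrite mulr1 /wpow big_nil mul1r; apply: le_trans (W0_le j).
    exact: (le_bigmax _ (fun p => `|W 0%N p j|)).
  by rewrite normr0 mulr0.
have {}IH := IH (ltnW lL).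
have dS M q : pdiff M (fun z => sigma (net_plain W v sigma l z q 0)).
  by apply: (pdiff_sigma_comp _ _ sigma sigma_smooth M 0); case: (IH q).
rewrite net_plainS; split=> [M|s y s0].
  by apply: pdiffD; [apply: pdiff_sum|apply: pdiff_cst].
rewrite wderivD; [|exact: pdiff_sum|exact: pdiff_cst].
rewrite wderiv_cst wderiv_sum //.
have -> : (if s is [::] then v l.+1 p 0 else 0) = 0 by case: (s) s0.
rewrite addr0; apply: le_trans (ler_norm_sum _ _ _) _.
have B q : `|wderiv s (fun z => sigma (net_plain W v sigma l z q 0)) y| <=
    wpow beta s * Gamma A Rs l.+1 (size s).
  by apply: sigma_comp_bound => //; case: (IH q) => // _ + t; apply.
apply: (@le_trans _ _ (\sum_q `|W l.+1 p q| * (wpow beta s * Gamma A Rs l.+1 (size s)))).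
  by apply: ler_sum => q _; rewrite normrM ler_wpM2l.
rewrite -mulr_suml [leRHS]mulrCA ler_wpM2r //.
  (* The bound is nonnegative because it dominates an absolute value; a component to take comes from
     the positive width. *)
  exact: le_trans (B (Ordinal (d_gt0 l.+1 (leqW lL)))).
apply: le_trans (W_le _ _) => //.
exact: (le_bigmax _ (fun p => \sum_q `|W l.+1 p q|)).
Qed.

End PlainNetwork.

(** * Shifted Stirling numbers and trigonometric forms *)

Section RStirling.
Variable R : realType.

(** The r-Stirling numbers with [r = k]: partitions of [m + k] elements into [p + k] blocks that
    separate [k] marked elements. *)
Definition rstirling (k m p : nat) : R :=
  (p`!%:R)^-1 * \sum_(i < p.+1) (-1) ^+ (p - i) * 'C(p, i)%:R * (i + k)%:R ^+ m.

Lemma rstirling_p0 k m : rstirling k m 0 = k%:R ^+ m.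
Proof. by rewrite /rstirling big_ord1 fact0 invr1 !mul1r. Qed.

Lemma rstirling_0S k p : rstirling k 0 p.+1 = 0.
Proof.
apply/eqP; rewrite mulf_eq0; apply/orP; right; apply/eqP.
transitivity ((-1 + 1 : R) ^+ p.+1); last by rewrite addNr expr0n.
by rewrite exprDn; apply: eq_bigr => i _; rewrite expr1n expr0 !mulr1 mulr_natr.
Qed.

(** Write one factor of [(i + k) ^+ m.+1] as [i + k]. The part [k] gives the first term; for the
    part [i], absorption of [i] into the binomial coefficient lowers [p] and raises [k]. *)
Lemma rstirlingS k m p :
  rstirling k m.+1 p.+1 = k%:R * rstirling k m p.+1 + rstirling k.+1 m p.
Proof.
have p0 : (p.+1%:R : R) != 0 by rewrite pnatr_eq0.
have f0 : (p`!%:R : R) != 0 by rewrite pnatr_eq0 -lt0n fact_gt0.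
have E : \sum_(i < p.+2) (-1) ^+ (p.+1 - i) * 'C(p.+1, i)%:R * (i + k)%:R ^+ m.+1 =
  k%:R * (\sum_(i < p.+2) (-1) ^+ (p.+1 - i) * 'C(p.+1, i)%:R * (i + k)%:R ^+ m) +
  p.+1%:R * \sum_(i < p.+1) (-1) ^+ (p - i) * 'C(p, i)%:R * (i + k.+1)%:R ^+ m :> R.
  transitivity (k%:R * (\sum_(i < p.+2) (-1) ^+ (p.+1 - i) * 'C(p.+1, i)%:R * (i + k)%:R ^+ m) +
    \sum_(i < p.+2) (-1) ^+ (p.+1 - i) * (i * 'C(p.+1, i))%:R * (i + k)%:R ^+ m :> R).
    rewrite mulr_sumr -big_split /=; apply: eq_bigr => i _.
    rewrite exprS natrM {1}natrD; ring.
  congr (_ + _); rewrite big_ord_recl mul0n mulr0 mul0r add0r mulr_sumr.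
  apply: eq_bigr => i _; rewrite lift0 subSS -(mul_bin_diag p.+1 i) addSnnS natrM /=.
  ring.
rewrite /rstirling E mulrDr; congr (_ + _); first by rewrite mulrCA.
by rewrite factS natrM invfM mulrACA mulVf // mul1r.
Qed.

Lemma rstirling_small k m p : (m < p)%N -> rstirling k m p = 0.
Proof.
elim: m k p => [|m IH] k [//|p]; first by rewrite rstirling_0S.
by rewrite ltnS => mp; rewrite rstirlingS IH ?mulr0 ?add0r ?IH // ltnW.
Qed.

Lemma rstirling_stirling m p : (p <= m)%N -> rstirling 0 m p = stirling R m p.
Proof.
move=> pm; rewrite /stirling; case: eqP => [->|_].
  by rewrite rstirling_p0 expr0n.
rewrite ltnNge pm /rstirling; congr (_ * _).
by apply: eq_bigr => i _; rewrite addn0.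
Qed.

(** Touchard polynomials in [c * 'X], for shifted Stirling numbers. The exponent of ['X] counts the
    derivatives that fall on [F]. *)
Definition touchard (k m : nat) (c : R) : {poly R} :=
  \sum_(p < m.+1) (rstirling k m p * c ^+ p) *: 'X^p.

Lemma touchard0 k c : touchard k 0 c = 1.
Proof. by rewrite /touchard big_ord1 rstirling_p0 mul1r scale1r. Qed.

Lemma touchardS k m c :
  touchard k m.+1 c = k%:R *: touchard k m c + c *: ('X * touchard k.+1 m c).
Proof.
rewrite /touchard; have -> : \sum_(p < m.+1) (rstirling k m p * c ^+ p) *: 'X^p =
   \sum_(p < m.+2) (rstirling k m p * c ^+ p) *: 'X^p.
  by rewrite [RHS]big_ord_recr /= rstirling_small // mul0r scale0r addr0.
rewrite [LHS]big_ord_recl [in RHS]big_ord_recl scalerDr -addrA; congr (_ + _).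
  by rewrite !rstirling_p0 /= scalerA exprS mulrA.
rewrite mulr_sumr !scaler_sumr -big_split; apply: eq_bigr => p _.
rewrite lift0 rstirlingS mulrDl scalerDl; congr (_ + _); first by rewrite -mulrA -scalerA.
by rewrite -[in RHS]scalerAr scalerA -exprS exprS mulrCA.
Qed.

End RStirling.
Arguments rstirling {R}.
Arguments touchard {R}.

(** * Umbral evaluation of polynomials *)

Section Umbral.
Variable R : realType.
Implicit Types (g : nat -> R) (p q : {poly R}).

(* The linear functional sending ['X^i] to [g i]. *)
Definition umbral g p : R := \sum_(i < size p) p`_i * g i.

Lemma umbral_widen g p N : (size p <= N)%N -> umbral g p = \sum_(i < N) p`_i * g i.
Proof.
move=> pN; rewrite /umbral (big_ord_widen N (fun i => p`_i * g i)) // big_mkcond /=.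
apply: eq_bigr => i _; case: ltnP => // sp.
by rewrite nth_default // mul0r.
Qed.

Lemma umbralD g p q : umbral g (p + q) = umbral g p + umbral g q.
Proof.
rewrite (umbral_widen g _ _ (size_polyD p q)).
rewrite (umbral_widen g p _ (leq_maxl _ (size q))).
rewrite (umbral_widen g q _ (leq_maxr (size p) _)) -big_split /=.
by apply: eq_bigr => i _; rewrite coefD mulrDl.
Qed.

Lemma umbralZ g c p : umbral g (c *: p) = c * umbral g p.
Proof.
rewrite (umbral_widen g _ _ (size_scale_leq c p)) /umbral mulr_sumr.
by apply: eq_bigr => i _; rewrite coefZ mulrA.
Qed.

Lemma umbral0 g : umbral g 0 = 0.
Proof. by rewrite /umbral size_poly0 big_ord0. Qed.

Lemma umbral_sum g (I : finType) (P : pred I) (F : I -> {poly R}) :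
  umbral g (\sum_(i | P i) F i) = \sum_(i | P i) umbral g (F i).
Proof. exact: (big_morph (umbral g) (umbralD g) (umbral0 g)). Qed.

(** This encodes a derivative falling on [F], which shifts the majorant, as a factor ['X]. *)
Lemma umbral_mulX g p : umbral g ('X * p) = umbral (fun i => g i.+1) p.
Proof.
rewrite (umbral_widen g _ (size p).+1); last first.
  by apply: leq_trans (size_polyMleq _ _) _; rewrite size_polyX.
by rewrite big_ord_recl coefXM /= mul0r add0r; apply: eq_bigr => i _; rewrite coefXM.
Qed.

Lemma umbral_scale g c p : umbral (fun i => c * g i) p = c * umbral g p.
Proof. by rewrite /umbral mulr_sumr; apply: eq_bigr => i _; rewrite mulrCA. Qed.

Lemma umbralXn g m : umbral g 'X^m = g m.
Proof.
rewrite /umbral size_polyXn (bigD1 ord_max) //= coefXn eqxx mul1r big1 ?addr0 //.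
move=> i /negPf im; rewrite coefXn.
by have -> : (i == m :> nat) = false by []; rewrite mul0r.
Qed.

End Umbral.
Arguments umbral {R}.

(** * Trigonometric forms in one variable *)

Section TrigForms.
Variable R : realType.

(* [trig_form k C f]: [f] is a homogeneous polynomial of degree [k] in
   [cos (2 pi t)] and [sin (2 pi t)] whose coefficients have l1-norm at most [C].
   Differentiation keeps the degree and multiplies the norm by [2 pi k]. *)
Inductive trig_form : nat -> R -> (R -> R) -> Prop :=
| trig1 : trig_form 0 1 (fun=> 1)
| trig_cos k C f : trig_form k C f -> trig_form k.+1 C (fun t => cos (2 * pi * t) * f t)
| trig_sin k C f : trig_form k C f -> trig_form k.+1 C (fun t => sin (2 * pi * t) * f t)
| trigD k C1 C2 f g : trig_form k C1 f -> trig_form k C2 g ->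
    trig_form k (C1 + C2) (fun t => f t + g t)
| trigZ k C a f : trig_form k C f -> trig_form k (`|a| * C) (fun t => a * f t).

Lemma trig_form_bound k C f t : trig_form k C f -> `|f t| <= C.
Proof.
elim=> {k C f} [|k C f _ IH|k C f _ IH|k C1 C2 f g _ IH1 _ IH2|k C a f _ IH].
- by rewrite normr1.
- rewrite normrM -[leRHS]mul1r ler_pM //.
  by rewrite ler_norml cos_geN1 cos_le1.
- rewrite normrM -[leRHS]mul1r ler_pM //.
  by rewrite ler_norml sin_geN1 sin_le1.
- by apply: le_trans (ler_normD _ _) _; apply: lerD.
- by rewrite normrM ler_wpM2l.
Qed.

Lemma is_derive_2pi (t : R) : is_derive t 1 (fun t => 2 * pi * t) (2 * pi).
Proof.
by apply: is_derive_affine => h; rewrite mulrDr [h *: 1]mulr1 mulrC.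
Qed.

Lemma is_derive_sin2pi (t : R) :
  is_derive t 1 (fun t => sin (2 * pi * t)) (2 * pi * cos (2 * pi * t)).
Proof.
have H := is_derive_comp _ _ _ _ _ _ _ _ (is_derive_sin (2 * pi * t)) (is_derive_2pi t).
by apply: is_derive_eq H _; rewrite mulrC.
Qed.

Lemma is_derive_cos2pi (t : R) :
  is_derive t 1 (fun t => cos (2 * pi * t)) (- (2 * pi) * sin (2 * pi * t)).
Proof.
have H := is_derive_comp _ _ _ _ _ _ _ _ (is_derive_cos (2 * pi * t)) (is_derive_2pi t).
by apply: is_derive_eq H _; rewrite mulrC mulrN mulNr.
Qed.

Lemma norm_2pi : `|2 * pi : R| = 2 * pi.
Proof. by rewrite ger0_norm // mulr_ge0 // pi_ge0. Qed.

Lemma trig_form_derive k C f : trig_form k C f -> exists f' : R -> R,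
  (forall t : R, is_derive t 1 f (f' t)) /\ trig_form k (2 * pi * k%:R * C) f'.
Proof.
elim=> {k C f} [|k C f tf [f' [df tf']]|k C f tf [f' [df tf']]
  |k C1 C2 f g _ [f' [df tf]] _ [g' [dg tg]]|k C a f _ [f' [df tf]]].
(* The zero derivative is written as a multiple of [1] so that [trigZ] gives it norm 0. *)
- exists (fun t => 0 * 1); split=> [t|]; first by rewrite mul0r; apply: is_derive_cst.
  have -> : 2 * pi * 0%:R * 1 = `|0 : R| * 1 :> R by rewrite mulr0 mul0r normr0 mul0r.
  exact/trigZ/trig1.
- exists (fun t => - (2 * pi) * (sin (2 * pi * t) * f t) + cos (2 * pi * t) * f' t).
  split=> [t|].
    have := is_deriveM (is_derive_cos2pi t) (df t).
    by move=> /is_derive_eq; apply; rewrite addrC /GRing.scale /=; ring.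
  have -> : 2 * pi * k.+1%:R * C = `|- (2 * pi)| * C + 2 * pi * k%:R * C.
    by rewrite normrN norm_2pi -natr1; ring.
  by apply: trigD; [apply/trigZ/trig_sin|apply: trig_cos].
- exists (fun t => 2 * pi * (cos (2 * pi * t) * f t) + sin (2 * pi * t) * f' t).
  split=> [t|].
    have := is_deriveM (is_derive_sin2pi t) (df t).
    by move=> /is_derive_eq; apply; rewrite addrC /GRing.scale /=; ring.
  have -> : 2 * pi * k.+1%:R * C = `|2 * pi| * C + 2 * pi * k%:R * C.
    by rewrite norm_2pi -natr1; ring.
  by apply: trigD; [apply/trigZ/trig_cos|apply: trig_sin].
- exists (fun t => f' t + g' t); split=> [t|]; first exact: is_deriveD.
  by rewrite mulrDr; apply: trigD.
- exists (fun t => a * f' t); split=> [t|]; first exact: is_deriveZ.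
  by rewrite mulrCA; apply: trigZ.
Qed.

End TrigForms.
Arguments trig_form {R}.

(** * The periodic network *)

Section PeriodicComposition.
Variables (R : realType) (n : nat).
Implicit Types (F : 'cV[R]_n -> R) (tau : 'I_n -> R -> R) (j : 'I_n) (y : 'cV[R]_n).

Definition sin_inp : 'cV[R]_n -> 'cV[R]_n := map_mx (fun t => sin (2 * pi * t)).

Definition trig_comp tau F y : R := (\prod_i tau i (y i 0)) * F (sin_inp y).

Definition upd (T : Type) (h : 'I_n -> T) j (a : T) : 'I_n -> T :=
  fun i => if i == j then a else h i.

Lemma prod_upd (S : comNzRingType) (T : Type) (H : 'I_n -> T -> S) (h : 'I_n -> T) j a :
  \prod_i H i (upd T h j a i) = H j a * \prod_(i | i != j) H i (h i).
Proof.
rewrite (bigD1 j) //= {1}/upd eqxx; congr (_ * _); apply: eq_bigr => i /negPf ij.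
by rewrite /upd ij.
Qed.

(** The product rule, where moving [y_j] changes only the factor [tau j] and the [j]-th entry of the
    sine input. Both terms have again the form [trig_comp]. *)
Lemma is_derive_trig_comp tau F j y (tau' : R -> R) :
  is_derive (y j 0) 1 (tau j) (tau' (y j 0)) -> pdiff 1 F ->
  is_derive y (delta_mx j 0) (trig_comp tau F)
    (trig_comp (upd _ tau j tau') F y +
     trig_comp (upd _ tau j (fun t => 2 * pi * (cos (2 * pi * t) * tau j t))) (pderiv j F) y).
Proof.
move=> dtau dF; pose K := \prod_(i | i != j) tau i (y i 0).
have dlin : is_derive y (delta_mx j 0) (fun z : 'cV[R]_n => z j 0) 1.
  by apply: is_derive_affine => h; rewrite !mxE !eqxx.
have dP : is_derive y (delta_mx j 0) (fun z => \prod_i tau i (z i 0)) (K * tau' (y j 0)).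
  apply/is_derive_line.
  have -> : (fun h : R => \prod_i tau i ((h *: delta_mx j 0 + y) i 0)) =
      fun h : R => K * tau j ((h *: delta_mx j 0 + y) j 0).
    apply/funext => h; rewrite (bigD1 j) //= mulrC; congr (_ * _).
    by apply: eq_bigr => i /negPf ij; rewrite !mxE ij mulr0 add0r.
  apply/(is_derive_line _ _ (fun z : 'cV[R]_n => K * tau j (z j 0)))/is_deriveZ.
  have := is_derive_comp _ _ _ _ _ _ _ _ dtau dlin.
  by rewrite mulr1.
have dS : is_derive y (delta_mx j 0) (fun z => F (sin_inp z))
    (pderiv j F (sin_inp y) * (2 * pi * cos (2 * pi * y j 0))).
  apply/is_derive_line.
  (* Along the line, [F] after the sine is [F] on the line through [sin_inp y] in direction [j], run
     through by the increment of the sine. *)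
  have -> : (fun h : R => F (sin_inp (h *: delta_mx j 0 + y))) =
      fun h : R => (fun r => F (r *: delta_mx j 0 + sin_inp y))
        (sin (2 * pi * (h *: delta_mx j 0 + y) j 0) - sin (2 * pi * y j 0)).
    apply/funext => h; congr F; apply/matrixP => i k; rewrite ord1 !mxE.
    case: (i =P j) => [->|_]; last by rewrite !mulr0 !add0r.
    by rewrite !eqxx !mulr1 subrK.
  apply/(is_derive_line _ _ (fun z : 'cV[R]_n => (fun r => F (r *: delta_mx j 0 + sin_inp y))
        (sin (2 * pi * z j 0) - sin (2 * pi * y j 0)))).
  apply: (is_derive_comp _ _ (fun r => F (r *: delta_mx j 0 + sin_inp y))).
    rewrite subrr; apply: (is_derive_line _ _ F _ _ _).1.
    exact: (is_derive_pderiv _ _ 0 F j _ dF).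
  have H := is_derive_comp _ _ _ _ _ _ _ _ (is_derive_sin2pi _ (y j 0)) dlin.
  have := is_deriveB H (is_derive_cst (sin (2 * pi * y j 0)) y (delta_mx j 0)).
  by rewrite mulr1 subr0.
have := is_deriveM dP dS; move=> /is_derive_eq; apply.
rewrite /trig_comp (prod_upd _ _ (fun i f => f (y i 0))).
rewrite (prod_upd _ _ (fun i f => f (y i 0))) -/K /GRing.scale /=.
rewrite [\prod_i _](bigD1 j) //= -/K.
ring.
Qed.

Lemma trig_form_upd (k : 'I_n -> nat) (C : 'I_n -> R) tau j k' C' f :
  (forall i, trig_form (k i) (C i) (tau i)) -> trig_form k' C' f ->
  forall i, trig_form (upd _ k j k' i) (upd _ C j C' i) (upd _ tau j f i).
Proof. by move=> H Hf i; rewrite /upd; case: eqP. Qed.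

Lemma pdiff_trig_comp N (k : 'I_n -> nat) (C : 'I_n -> R) tau F :
  (forall i, trig_form (k i) (C i) (tau i)) -> (forall M, pdiff M F) ->
  pdiff N (trig_comp tau F).
Proof.
elim: N k C tau F => // N IH k C tau F Ht dF j.
have [tau' [dtau Ht']] := trig_form_derive _ _ _ _ (Ht j).
have dE y := is_derive_trig_comp tau F j y tau' (dtau _) (dF 1%N).
split=> [y|]; first by case: (dE y).
have -> : pderiv j (trig_comp tau F) = _ := funext (fun y => derive_val (is_derive := dE y)).
apply: pdiffD.
  exact: (IH _ _ _ _ (trig_form_upd _ _ _ j _ _ _ Ht Ht') dF).
have Ht2 := trig_form_upd _ _ _ j _ _ _ Ht
  (trigZ _ _ _ (2 * pi) _ (trig_cos _ _ _ _ (Ht j))).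
apply: (IH _ _ _ _ Ht2).
by move=> M; case: (dF M.+1 j).
Qed.

(** Of the two terms of the innermost derivative, one multiplies [C j] by [2 * pi * k j]; the other
    raises [k j], multiplies [C j] by [2 * pi] and shifts [g] with a factor [beta j]. Their sum is
    the recursion [touchardS] under [umbral g]. *)
Lemma trig_comp_bound (beta g : nat -> R) s k C tau F y :
  (forall i, trig_form (k i) (C i) (tau i)) -> (forall M, pdiff M F) ->
  (forall t, `|wderiv t F (sin_inp y)| <= wpow beta t * g (size t)) ->
  `|wderiv s (trig_comp tau F) y| <=
  (2 * pi) ^+ size s * (\prod_i C i) *
    umbral g (\prod_i touchard (k i) (count_mem i s) (beta i)).
Proof.
elim/last_ind: s k C tau F g => [|s j IH] k C tau F g Ht dF bF.
  rewrite expr0 mul1r [X in umbral g X]big1 => [|i _]; last by rewrite touchard0.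
  have -> : umbral g 1 = g 0%N by rewrite -(umbralXn _ g 0) expr0.
  rewrite /trig_comp normrM normr_prod ler_pM //.
  - by apply: prodr_ge0.
  - by apply: ler_prod => i _; rewrite normr_ge0 /= (trig_form_bound _ _ _ _ _ (Ht i)).
  - by have := bF [::]; rewrite /wpow big_nil mul1r.
have [tau' [dtau Ht']] := trig_form_derive _ _ _ _ (Ht j).
have dE z := is_derive_trig_comp tau F j z tau' (dtau _) (dF 1%N).
have Ht1 := trig_form_upd _ _ _ j _ _ _ Ht Ht'.
have Ht2 := trig_form_upd _ _ _ j _ _ _ Ht (trigZ _ _ _ (2 * pi) _ (trig_cos _ _ _ _ (Ht j))).
have dF' M : pdiff M (pderiv j F) by case: (dF M.+1 j).
have B1 := IH _ _ _ _ _ Ht1 dF bF.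
have bF' t : `|wderiv t (pderiv j F) (sin_inp y)| <=
    wpow beta t * (beta j * g (size t).+1).
  by rewrite -wderiv_rcons mulrA -wpow_rcons -(size_rcons t j).
have B2 := IH _ _ _ _ (fun i => beta j * g i.+1) Ht2 dF' bF'.
rewrite wderiv_rcons.
have -> : pderiv j (trig_comp tau F) = _ := funext (fun z => derive_val (is_derive := dE z)).
rewrite wderivD; last 2 first.
- exact: pdiff_trig_comp Ht1 dF.
- exact: pdiff_trig_comp Ht2 dF'.
apply: le_trans (ler_normD _ _) _; apply: le_trans (lerD B1 B2) _.
rewrite le_eqVlt; apply/predU1P; left.
rewrite !(prod_upd _ _ (fun _ c => c)) norm_2pi.
rewrite (prod_upd _ _ (fun i m => touchard m (count_mem i s) (beta i))).
rewrite (prod_upd _ _ (fun i m => touchard m (count_mem i s) (beta i))).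
rewrite size_rcons exprS [in RHS](bigD1 j) //= [\prod_i touchard _ _ _](bigD1 j) //=.
set Q := \prod_(i | i != j) touchard (k i) (count_mem i s) (beta i).
have -> : \prod_(i | i != j) touchard (k i) (count_mem i (rcons s j)) (beta i) = Q.
  apply: eq_bigr => i /negPf ij.
  by rewrite -cats1 count_cat /= eq_sym ij addn0 addn0.
rewrite -cats1 count_cat /= eqxx addn0 addn1 touchardS.
rewrite [(_ + _) * Q]mulrDl umbralD.
have umbralZM c (T : {poly R}) : umbral g (c *: T * Q) = c * umbral g (T * Q).
  by rewrite -scalerAl umbralZ.
rewrite !umbralZM -['X * _ * Q]mulrA umbral_mulX umbral_scale.
ring.
Qed.

End PeriodicComposition.

(** * Stirling sums and the final bounds *)

Lemma leq_mabs n (nu : 'I_n -> nat) i : (nu i <= mabs nu)%N.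
Proof. by rewrite /mabs (bigD1 i) //= leq_addr. Qed.

(** Distributing the product over the sums chooses an exponent [m i] in each factor; the monomial of
    total degree [mabs m] evaluates to [g (mabs m)]. All exponents fit the range since
    [nu i <= mabs nu]. *)
Lemma umbral_prod_touchard (R : realType) n (nu : 'I_n -> nat) (beta g : nat -> R) :
  umbral g (\prod_i touchard 0 (nu i) (beta i)) =
  \sum_(m : {ffun 'I_n -> 'I_(mabs nu).+1} | [forall j, (m j <= nu j)%N])
    mpow beta (fun j => nat_of_ord (m j)) * g (mabs (fun j => nat_of_ord (m j)))
      * mstirling R nu (fun j => nat_of_ord (m j)).
Proof.
have -> : \prod_i touchard 0 (nu i) (beta i) =
    \prod_i \sum_(p < (mabs nu).+1 | (p <= nu i)%N)
      (rstirling 0 (nu i) p * beta i ^+ p) *: 'X^p.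
  apply: eq_bigr => i _; rewrite /touchard.
  by rewrite (big_ord_widen (mabs nu).+1 (fun p => (rstirling 0 (nu i) p * beta i ^+ p) *: 'X^p))
    ?ltnS ?leq_mabs.
rewrite bigA_distr_big_dep umbral_sum; apply: eq_big => [m|m /familyP mP].
  by apply/familyP/forallP.
rewrite scaler_prod umbralZ -expr_sum umbralXn big_split /= /mpow /mstirling /mabs.
rewrite -[LHS]mulrA [LHS]mulrC; congr (_ * _).
by apply: eq_bigr => i _; rewrite rstirling_stirling //; exact: mP.
Qed.

Lemma net_periodicE (R : realType) (d : nat -> nat) (W : forall l, 'M[R]_(d l.+1, d l))
    (v : forall l, 'cV[R]_(d l.+1)) sigma l y :
  net_periodic W v sigma l y = net_plain W v sigma l (sin_inp R _ y).
Proof. by elim: l => //= l IH; rewrite /net_periodic /net_plain /= in IH *; rewrite IH. Qed.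

Theorem theorem2p1 (R : realType) (L : nat) (d : nat -> nat)
  (W : forall l, 'M[R]_(d l.+1, d l)) (v : forall l, 'cV[R]_(d l.+1))
  (sigma : R -> R) (beta Rs A : nat -> R) :
  (1 <= d 0%N)%N -> (1 <= L)%N ->
  (forall l, (l <= L.+1)%N -> (1 <= d l)%N) ->
  smooth sigma ->
  (forall j, (j < d 0%N)%N -> 0 < beta j) ->
  (forall l, (1 <= l)%N -> 0 < Rs l) ->
  (forall n, (1 <= n)%N -> 0 < A n) ->
  (forall (j : 'I_(d 0%N)), \big[Num.max/0]_(p < d 1%N) `|W 0%N p j| <= beta j) ->
  (forall l, (1 <= l <= L)%N -> mx_inf_norm (W l) <= Rs l) ->
  (forall n, (1 <= n)%N -> forall x, `|derive1n n sigma x| <= A n) ->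
  forall l, (1 <= l <= L)%N -> forall (p : 'I_(d l.+1)) (nu : 'I_(d 0%N) -> nat),
  (mabs nu != 0)%N -> forall y : 'cV[R]_(d 0%N),
    `|mderiv nu (fun z => net_plain W v sigma l z p 0) y|
      <= Rs l * mpow beta nu * Gamma A Rs l (mabs nu)
  /\
    `|mderiv nu (fun z => net_periodic W v sigma l z p 0) y|
      <= Rs l * (2 * pi) ^+ mabs nu *
         \sum_(m : {ffun 'I_(d 0%N) -> 'I_(mabs nu).+1} | [forall j, (m j <= nu j)%N])
           mpow beta (fun j => nat_of_ord (m j)) * Gamma A Rs l (mabs (fun j => nat_of_ord (m j)))
             * mstirling R nu (fun j => nat_of_ord (m j)).
Proof.
move=> _ _ d0 smooth_sigma _ _ _ W0_le W_le sigma_le l /andP[l0 lL] p nu nu0 y.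
have [dG bG] := net_plain_bound R L d W v sigma beta Rs A d0 smooth_sigma W0_le W_le
  sigma_le l lL p.
have majE m : net_majorant R Rs A l m = Rs l * Gamma A Rs l m by case: (l) l0.
split.
  rewrite mderiv_word -wpow_word_of -size_word_of.
  rewrite [Rs l * _]mulrC -mulrA -majE; apply: bG.
  by rewrite -size_eq0 size_word_of.
(* The network itself has no bound; its value serves as majorant of order 0, where
   the Stirling coefficient vanishes. *)
pose g m := if m is 0 then `|net_plain W v sigma l (sin_inp R _ y) p 0|
  else Rs l * Gamma A Rs l m.
rewrite mderiv_word.
(* Trigonometric factors constantly [1], of degree 0 and norm 1, start the recursion at [k = 0],
   where the ordinary Stirling numbers appear. *)
have -> : (fun z => net_periodic W v sigma l z p 0) =
    trig_comp R _ (fun _ _ => 1) (fun z => net_plain W v sigma l z p 0).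
  by apply/funext => z; rewrite net_periodicE /trig_comp big1 ?mul1r.
have := trig_comp_bound R _ beta g (word_of nu) (fun=> 0%N) (fun=> 1) (fun _ _ => 1) _ y
  (fun=> trig1 R) dG.
move=> /(_ _)/le_trans; apply.
  case=> [|j t]; first by rewrite /wpow big_nil mul1r.
  by rewrite [g _]/= -majE; apply: bG.
rewrite big1 // mulr1 size_word_of.
under eq_bigr do rewrite count_word_of.
rewrite umbral_prod_touchard [Rs l * _]mulrC -mulrA ler_wpM2l //.
  by rewrite exprn_ge0 // mulr_ge0 // pi_ge0.
rewrite mulr_sumr le_eqVlt; apply/predU1P; left; apply: eq_bigr => m _.
(* Only at total order 0 can [g] differ from [Rs l * Gamma A Rs l]; there every [m j] is zero, and a
   [j] with [nu j] nonzero annihilates the product. *)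
have [m0|m0] := eqVneq (mabs (fun j => nat_of_ord (m j))) 0%N; last first.
  by rewrite /g; case: (mabs _) m0 => // k _; ring.
suff -> : mstirling R nu (fun j => nat_of_ord (m j)) = 0 by rewrite !mulr0.
have [j nuj] : exists j, nu j != 0%N.
  apply/existsP; rewrite -negb_forall; apply: contra nu0 => /forallP nu0.
  by rewrite /mabs big1 // => j _; apply/eqP.
have mj : nat_of_ord (m j) = 0%N.
  apply/eqP; rewrite -leqn0; apply: leq_trans (eq_leq m0).
  exact: (leq_mabs _ (fun j => nat_of_ord (m j))).
by rewrite /mstirling (bigD1 j) //= mj /stirling eqxx (negPf nuj) mul0r.
Qed.
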